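(* Let $\gamma \geq 0$ be an integer. The operad $\mathsf{DAs}_\gamma$ admits the following presentation. It is generated by $\{\diamond_b : b \in [\gamma]\}$ and its space of relations is generated by $$\diamond_a \circ_1 \diamond_a - \diamond_a \circ_2 \diamond_a, \qquad a \in [\gamma].$$
   Context: The ground field has characteristic zero; operad means nonsymmetric operad; $[n] = \{1, \dots, n\}$; $a \uparrow a' := \max(a, a')$. $\mathbf{Free}(\mathfrak{G})$ is the free operad on a set $\mathfrak{G}$ of binary generators; $(\mathfrak{G}, \mathfrak{R})$ is a presentation of $\mathcal{O}$ if $\mathcal{O} \cong \mathbf{Free}(\mathfrak{G})/\langle \mathfrak{R} \rangle$. $\mathsf{As}_\gamma$ is the operad with presentation given by binary generators $\star_a$, $a \in [\gamma]$, and the space of relations generated by $\star_a \circ_1 \star_{a'} - \star_{a \uparrow a'} \circ_2 \star_{a \uparrow a'}$ and $\star_a \circ_2 \star_{a'} - \star_{a \uparrow a'} \circ_2 \star_{a \uparrow a'}$, $a, a' \in [\gamma]$. Koszul dual: if $\mathcal{O}$ has a presentation $(\mathfrak{G}, \mathfrak{R})$ with $\mathfrak{G}$ in arity $2$ and $\mathfrak{R} \subseteq \mathbf{Free}(\mathfrak{G})(3)$, its Koszul dual is $\mathbf{Free}(\mathfrak{G})/\langle \mathfrak{R}^\perp \rangle$, where $\mathfrak{R}^\perp$ is the annihilator of $\mathfrak{R}$ in $\mathbf{Free}(\mathfrak{G})(3)$ for the bilinear form with $\langle x \circ_i y, x' \circ_{i'} y' \rangle = 1$ if $x = x', y = y',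 i = i' = 1$; $= -1$ if $x = x', y = y', i = i' = 2$; and $0$ otherwise ($x, x', y, y' \in \mathfrak{G}$). $\mathsf{DAs}_\gamma$ is the Koszul dual of $\mathsf{As}_\gamma$ computed from this presentation, where in the dual the generator corresponding to $\star_a$ is denoted by $\lozenge_a$. In $\mathbf{Free}(\{\lozenge_a : a \in [\gamma]\})(2)$ set $\diamond_b := \sum_{a \in [b]} \lozenge_a$ for $b \in [\gamma]$. These elements form a basis of this space, so that the free operads on $\{\lozenge_a\}$ and on $\{\diamond_b\}$ are identified. *)

(* Defs.v *)
From HB Require Import structures.
From mathcomp Require Import all_boot all_order all_algebra.
From mathcomp Require Import boolp.
From mathcomp Require Import freeg.

Set Implicit Arguments.
Unset Strict Implicit.
Unset Printing Implicit Defensive.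

Import Order.TTheory GRing.Theory.

Local Open Scope ring_scope.
Local Open Scope quotient_scope.

Section Transport.
Variables (R : pzRingType) (V : nat -> lmodType R).

Definition transport n m (e : n = m) (x : V n) : V m := ecast k (V k) e x.

Lemma transport_is_linear n m (e : n = m) : linear (transport e).
Proof. by case: _ / e. Qed.

HB.instance Definition _ n m (e : n = m) :=
  GRing.isLinear.Build R (V n) (V m) _ (transport e) (transport_is_linear e).

End Transport.

(** Arities start at 1 and are shifted: [P n] is the component of arity
    [n.+1], so that composing arities [n.+1] and [m.+1] gives arity
    [(n + m).+1]. Positions are counted from 0: [opd_comp i] is the partial
    composition usually written with index [i + 1]. *)
Record operad (K : fieldType) := Operad {
  opd :> nat -> lmodType K;
  opd_unit : opd 0%N;
  opd_comp : forall n m, 'I_n.+1 -> opd n -> opd m -> opd (n + m)%N;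
  opd_linl : forall n m (i : 'I_n.+1) (y : opd m),
    linear (fun x => opd_comp i x y);
  opd_linr : forall n m (i : 'I_n.+1) (x : opd n),
    linear (opd_comp (m := m) i x);
  opd_comp1l : forall n (x : opd n), opd_comp ord0 opd_unit x = x;
  opd_comp1r : forall n (i : 'I_n.+1) (x : opd n),
    transport (addn0 n) (opd_comp i x opd_unit) = x;
  opd_compA : forall n m p (i : 'I_n.+1) (j : 'I_m.+1)
      (x : opd n) (y : opd m) (z : opd p),
    opd_comp i x (opd_comp j y z) =
    transport (esym (addnA n m p))
      (opd_comp (inord (i + j)) (opd_comp i x y) z);
  opd_compC : forall n m p (i j : 'I_n.+1)
      (x : opd n) (y : opd m) (z : opd p), (i < j)%N ->
    opd_comp (inord (j + m)) (opd_comp i x y) z =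
    transport (addnAC n p m)
      (opd_comp (inord i) (opd_comp j x z) y)
}.

Record operad_morphism (K : fieldType) (P Q : operad K) := OperadMorphism {
  opmap :> forall n, {linear P n -> Q n};
  opmap_unit : opmap 0%N (opd_unit P) = opd_unit Q;
  opmap_comp : forall n m (i : 'I_n.+1) (x : P n) (y : P m),
    opmap (n + m)%N (opd_comp i x y) = opd_comp i (opmap n x) (opmap m y)
}.

Definition operad_isomorphism (K : fieldType) (P Q : operad K)
  (phi : operad_morphism P Q) : Prop := forall n, bijective (phi n).

Record operad_ideal (K : fieldType) (P : operad K) := OperadIdeal {
  idl :> forall n, P n -> Prop;
  idl0 : forall n, idl (0 : P n);
  idl_lin : forall n (a : K) (x y : P n), idl x -> idl y -> idl (a *: x + y);
  idl_compl : forall n m (i : 'I_n.+1) (x : P n) (y : P m),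
    idl x -> idl (opd_comp i x y);
  idl_compr : forall n m (i : 'I_n.+1) (x : P n) (y : P m),
    idl y -> idl (opd_comp i x y)
}.

Section QuotientModule.
Variables (K : fieldType) (P : operad K) (I : operad_ideal P) (n : nat).

Definition idl_pred : {pred P n} := fun x => `[< I n x >].

Lemma idl_predE x : (x \in idl_pred) = `[< I n x >]. Proof. by []. Qed.

Lemma idl_pred_zmod_closed : zmod_closed idl_pred.
Proof.
split; first by rewrite idl_predE; apply/asboolP/idl0.
move=> x y; rewrite !idl_predE => /asboolP Ix /asboolP Iy; apply/asboolP.
by rewrite addrC -scaleN1r; apply: idl_lin.
Qed.

HB.instance Definition _ :=
  GRing.isZmodClosed.Build (P n) idl_pred idl_pred_zmod_closed.

Definition opquot : Type := Quotient.quot idl_pred.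

HB.instance Definition _ := GRing.Zmodule.on opquot.
HB.instance Definition _ := Quotient.on opquot.

Definition opclass (x : P n) : opquot := \pi_(Quotient.quot idl_pred) x.

Lemma opclassP (x y : P n) : opclass x = opclass y <-> I n (x - y).
Proof.
rewrite /opclass; split.
  by move/eqP; rewrite -Quotient.idealrBE => /asboolP.
by move=> h; apply/eqP; rewrite -Quotient.idealrBE; apply/asboolP.
Qed.

Lemma opclassD : {morph opclass : x y / x + y}.
Proof. by move=> x y; rewrite /opclass raddfD. Qed.

Lemma opclass_repr (u : opquot) : opclass (repr u) = u.
Proof. exact: reprK. Qed.

Definition opquot_scale (a : K) (u : opquot) : opquot :=
  opclass (a *: repr u).

Lemma opquot_scaleE a x : opquot_scale a (opclass x) = opclass (a *: x).
Proof.
apply/opclassP; rewrite -scalerBr -[_ *: _]addr0.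
by apply: idl_lin; [apply/opclassP; rewrite opclass_repr | apply: idl0].
Qed.

Fact opquot_scaleA a b u :
  opquot_scale a (opquot_scale b u) = opquot_scale (a * b) u.
Proof. by rewrite -[u]opclass_repr !opquot_scaleE scalerA. Qed.

Fact opquot_scale1 : left_id 1 opquot_scale.
Proof. by move=> u; rewrite -[u]opclass_repr !opquot_scaleE scale1r. Qed.

Fact opquot_scaleDr : right_distributive opquot_scale +%R.
Proof.
move=> a u v; rewrite -[u]opclass_repr -[v]opclass_repr -opclassD.
by rewrite !opquot_scaleE -opclassD scalerDr.
Qed.

Fact opquot_scaleDl u : {morph opquot_scale^~ u : a b / a + b}.
Proof.
by move=> a b; rewrite -[u]opclass_repr !opquot_scaleE -opclassD scalerDl.
Qed.

HB.instance Definition _ := GRing.Zmodule_isLmodule.Build K opquot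
  opquot_scaleA opquot_scale1 opquot_scaleDr opquot_scaleDl.

Lemma opclass_is_linear : linear opclass.
Proof. by move=> a x y; rewrite opclassD -opquot_scaleE. Qed.

HB.instance Definition _ :=
  GRing.isLinear.Build K (P n) opquot _ opclass opclass_is_linear.

End QuotientModule.

Section QuotientOperad.
Variables (K : fieldType) (P : operad K) (I : operad_ideal P).

Local Notation Q := (fun n => opquot I n : lmodType K).

Definition opquot_comp n m (i : 'I_n.+1) (u : Q n) (v : Q m) : Q (n + m)%N :=
  opclass I (opd_comp i (repr u) (repr v)).

Lemma opquot_compE n m (i : 'I_n.+1) (x : P n) (y : P m) :
  opquot_comp i (opclass I x) (opclass I y) = opclass I (opd_comp i x y).
Proof.
have linB (V W : lmodType K) (f : V -> W) : linear f -> {morph f : a b / a - b}.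
  by move=> lf a b; rewrite -![_ - b]addrC -!scaleN1r lf scaleN1r addrC.
apply: (@eq_trans _ _ (opclass I (opd_comp i x (repr (opclass I y))))).
  apply/opclassP; rewrite -(linB _ _ _ (opd_linl i _)).
  by apply: idl_compl; apply/opclassP; rewrite opclass_repr.
apply/opclassP; rewrite -(linB _ _ _ (opd_linr i _)).
by apply: idl_compr; apply/opclassP; rewrite opclass_repr.
Qed.

Lemma transport_opclass n m (e : n = m) (x : P n) :
  transport (V := Q) e (opclass I x) = opclass I (transport e x).
Proof. by case: _ / e. Qed.

Fact opquot_linl n m (i : 'I_n.+1) (v : Q m) :
  linear (fun u => opquot_comp i u v).
Proof.
move=> a u u'; rewrite -[u]opclass_repr -[u']opclass_repr -[v]opclass_repr.
by rewrite -linearP !opquot_compE opd_linl linearP.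
Qed.

Fact opquot_linr n m (i : 'I_n.+1) (u : Q n) :
  linear (opquot_comp (m := m) i u).
Proof.
move=> a v v'; rewrite -[u]opclass_repr -[v]opclass_repr -[v']opclass_repr.
by rewrite -linearP !opquot_compE opd_linr linearP.
Qed.

Fact opquot_comp1l n (u : Q n) :
  opquot_comp ord0 (opclass I (opd_unit P)) u = u.
Proof. by rewrite -[u]opclass_repr opquot_compE opd_comp1l. Qed.

Fact opquot_comp1r n (i : 'I_n.+1) (u : Q n) :
  transport (V := Q) (addn0 n) (opquot_comp i u (opclass I (opd_unit P))) = u.
Proof.
by rewrite -[u]opclass_repr opquot_compE transport_opclass opd_comp1r.
Qed.

Fact opquot_compA n m p (i : 'I_n.+1) (j : 'I_m.+1)
    (u : Q n) (v : Q m) (w : Q p) :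
  opquot_comp i u (opquot_comp j v w) =
  transport (V := Q) (esym (addnA n m p))
    (opquot_comp (inord (i + j)) (opquot_comp i u v) w).
Proof.
rewrite -[u]opclass_repr -[v]opclass_repr -[w]opclass_repr !opquot_compE.
by rewrite transport_opclass -opd_compA.
Qed.

Fact opquot_compC n m p (i j : 'I_n.+1)
    (u : Q n) (v : Q m) (w : Q p) : (i < j)%N ->
  opquot_comp (inord (j + m)) (opquot_comp i u v) w =
  transport (V := Q) (addnAC n p m)
    (opquot_comp (inord i) (opquot_comp j u w) v).
Proof.
move=> ij; rewrite -[u]opclass_repr -[v]opclass_repr -[w]opclass_repr.
by rewrite !opquot_compE transport_opclass -opd_compC.
Qed.

Definition quotient_operad : operad K :=
  Operad opquot_linl opquot_linr opquot_comp1l opquot_comp1r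
    opquot_compA opquot_compC.

Definition quotient_map n : {linear P n -> quotient_operad n} :=
  @opclass K P I n.

End QuotientOperad.

Section GeneratedIdeal.
Variables (K : fieldType) (P : operad K) (k : nat) (R : P k -> Prop).

Inductive gen_ideal_mem : forall n, P n -> Prop :=
| gen_ideal_in (x : P k) : R x -> gen_ideal_mem x
| gen_ideal0 n : gen_ideal_mem (0 : P n)
| gen_ideal_lin n (a : K) (x y : P n) :
    gen_ideal_mem x -> gen_ideal_mem y -> gen_ideal_mem (a *: x + y)
| gen_ideal_compl n m (i : 'I_n.+1) (x : P n) (y : P m) :
    gen_ideal_mem x -> gen_ideal_mem (opd_comp i x y)
| gen_ideal_compr n m (i : 'I_n.+1) (x : P n) (y : P m) :
    gen_ideal_mem y -> gen_ideal_mem (opd_comp i x y).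

Definition gen_ideal : operad_ideal P :=
  OperadIdeal gen_ideal0 gen_ideal_lin gen_ideal_compl gen_ideal_compr.

End GeneratedIdeal.

Inductive linspan (K : fieldType) (V : lmodType K) (S : V -> Prop) : V -> Prop :=
| linspan0 : linspan S 0
| linspan_lin a x y : S x -> linspan S y -> linspan S (a *: x + y).

Inductive btree (G : Type) : Type :=
| Leaf
| Node of G & btree G & btree G.
Arguments Leaf {G}.

Section BTreeChoice.
Variable G : choiceType.

Fixpoint btree_encode (t : btree G) : GenTree.tree G :=
  if t is Node g l r then
    GenTree.Node 0 [:: GenTree.Leaf g; btree_encode l; btree_encode r]
  else GenTree.Node 1 [::].

Fixpoint btree_decode (u : GenTree.tree G) : option (btree G) :=
  match u with
  | GenTree.Node 0 [:: GenTree.Leaf g; l; r] =>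
      if (btree_decode l, btree_decode r) is (Some l', Some r')
      then Some (Node g l' r') else None
  | GenTree.Node 1 [::] => Some Leaf
  | _ => None
  end.

Lemma btree_encodeK : pcancel btree_encode btree_decode.
Proof. by elim=> //= g l -> r ->. Qed.

HB.instance Definition _ := Choice.copy (btree G) (pcan_type btree_encodeK).

End BTreeChoice.

Fixpoint nnodes (G : Type) (t : btree G) : nat :=
  if t is Node _ l r then (nnodes l + nnodes r).+1 else 0.

(** [graft i t s] plugs [s] into the leaf number [i] of [t]; leaves are
    numbered from left to right starting at 0, and a tree with [n] internal
    nodes has [n.+1] leaves. *)
Fixpoint graft (G : Type) (i : nat) (t s : btree G) : btree G :=
  if t is Node g l r then
    if (i <= nnodes l)%N then Node g (graft i l s) r
    else Node g l (graft (i - (nnodes l).+1) r s)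
  else s.

Section GraftTheory.
Variable G : Type.
Implicit Types t s u : btree G.

Lemma nnodes_graft i t s : nnodes (graft i t s) = (nnodes t + nnodes s)%N.
Proof.
elim: t i => [|g l IHl r IHr] i //=; case: ifP => _ /=.
  by rewrite IHl addSn addnAC.
by rewrite IHr addSn addnA.
Qed.

Lemma graft_leaf i t : graft i t Leaf = t.
Proof.
by elim: t i => [|g l IHl r IHr] i //=; case: ifP => _; rewrite ?IHl ?IHr.
Qed.

Lemma graftA i j t s u : (i <= nnodes t)%N -> (j <= nnodes s)%N ->
  graft i t (graft j s u) = graft (i + j) (graft i t s) u.
Proof.
elim: t i => [|g l IHl r IHr] i /= ht hj; first by case: i ht.
case: ifP => hi /=; first by rewrite nnodes_graft leq_add // IHl.
have {}hi : (nnodes l < i)%N by rewrite ltnNge hi.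
rewrite leqNgt ltn_addr //= IHr //; last by rewrite leq_subLR addSn.
by rewrite addnBAC.
Qed.

Lemma graftC i j t s u : (i < j)%N -> (j <= nnodes t)%N ->
  graft (j + nnodes s) (graft i t s) u = graft i (graft j t u) s.
Proof.
elim: t i j => [|g l IHl r IHr] i j /= hij hj; first by case: j hij hj.
have [hjl|hjl] := leqP j (nnodes l).
  rewrite (leq_trans (ltnW hij) hjl) /= nnodes_graft leq_add2r hjl.
  by rewrite nnodes_graft (leq_trans _ (leq_addr _ _)) ?IHl // ltnW // (leq_trans hij).
have [hil|hil] := leqP i (nnodes l) => /=.
  by rewrite nnodes_graft leq_add2r leqNgt hjl /= hil -addSn subnDr.
rewrite (leqNgt i) hil /= leqNgt (leq_trans hjl (leq_addr _ _)) /=.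
by rewrite -addnBAC // IHr ?leq_subLR ?addSn // ltn_sub2r // (leq_ltn_trans hil).
Qed.

End GraftTheory.

Section FreeOperad.
Variables (K : fieldType) (G : choiceType).

Definition tree (n : nat) : choiceType := {t : btree G | nnodes t == n}.

(** In arity [n.+1] the free operad on [G] has for basis the binary trees with
    [n] internal nodes, each labelled by [G]. *)
Definition free_mod (n : nat) : lmodType K := {freeg (tree n) / K}.

Fact tree_graft_subproof n m i (t : tree n) (s : tree m) :
  nnodes (graft i (val t) (val s)) == (n + m)%N.
Proof. by rewrite nnodes_graft (eqP (valP t)) (eqP (valP s)). Qed.

Definition tree_graft n m i (t : tree n) (s : tree m) : tree (n + m) :=
  Sub (graft i (val t) (val s)) (tree_graft_subproof i t s).

Definition tree_leaf : tree 0 := Sub Leaf (eqxx 0%N).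

Definition tree_corolla (g : G) : tree 1 :=
  Sub (Node g Leaf Leaf) (eqxx 1%N).

Definition free_comp n m (i : 'I_n.+1) (x : free_mod n) (y : free_mod m) :
    free_mod (n + m)%N :=
  fglift (fun t => fglift (fun s => << tree_graft i t s >> : free_mod _) y) x.

End FreeOperad.

Section FreegLift.
Variables (K : fieldType) (T : choiceType).
Local Notation F := {freeg T / K}.

Lemma fgliftU (M : lmodType K) (f : T -> M) t : fglift f (<< t >> : F) = f t.
Proof. by rewrite liftU scale1r. Qed.

Lemma fglift_is_linear (M : lmodType K) (f : T -> M) :
  linear (fglift f : F -> M).
Proof.
have fB := lift_is_additive f.
have f0 : fglift f (0 : F) = 0 by rewrite -(subr0 0) fB subrr.
have fD x y : fglift f (x + y : F) = fglift f x + fglift f y.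
  by rewrite -[y in LHS]opprK -[- y]sub0r !fB f0 sub0r opprK.
have fS (r : seq T) (g : T -> F) :
    fglift f (\sum_(z <- r) g z) = \sum_(z <- r) fglift f (g z).
  exact: (big_morph _ fD f0).
move=> a x y; rewrite fD; congr (_ + _).
have -> : a *: x = \sum_(z <- dom x) << a * coeff z x *g z >> by [].
rewrite -[in RHS](freeg_sumE x) !fS scaler_sumr.
by apply: eq_bigr => z _; rewrite !liftU scalerA.
Qed.

Lemma freeg_linear_ext (M : lmodType K) (f g : F -> M) :
  linear f -> linear g -> (forall t, f << t >> = g << t >>) -> f =1 g.
Proof.
move=> lf lg fg x.
pose hf := GRing.isLinear.Build K F M _ f lf.
pose hg := GRing.isLinear.Build K F M _ g lg.
pose f' : {linear F -> M} := HB.pack f hf.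
pose g' : {linear F -> M} := HB.pack g hg.
suff : f' x = g' x by [].
rewrite -(freeg_sumE x) !linear_sum; apply: eq_bigr => t _.
have -> : << coeff t x *g t >> = coeff t x *: (<< t >> : F).
  by apply/eqP/freeg_eqP => s; rewrite coeffZ !coeffU mul1r.
by rewrite !linearZ; congr (_ *: _); apply: fg.
Qed.

End FreegLift.

Section FreeOperadLaws.
Variables (K : fieldType) (G : choiceType).
Local Notation F := (free_mod K G).
Local Notation b t := (<< t >> : F _).

Lemma free_compU n m (i : 'I_n.+1) (t : tree G n) (s : tree G m) :
  free_comp i (b t) (b s) = b (tree_graft i t s).
Proof. by rewrite /free_comp !fgliftU. Qed.

Fact free_linl n m (i : 'I_n.+1) (y : F m) :
  linear (fun x : F n => free_comp i x y).
Proof. exact: fglift_is_linear. Qed.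

Fact free_linr n m (i : 'I_n.+1) (x : F n) :
  linear (free_comp (m := m) i x).
Proof.
move=> a y y'; move: x; apply: freeg_linear_ext.
- exact: free_linl.
- move=> c x x' /=; rewrite !free_linl !scalerDr !scalerA (mulrC a).
  by rewrite addrACA.
- by move=> t; rewrite /free_comp !fgliftU fglift_is_linear.
Qed.

Lemma transport_freeU n m (e : n = m) (t : tree G n) (t' : tree G m) :
  val t = val t' -> transport (V := F) e (b t) = b t'.
Proof. by case: _ / e t' => t' /val_inj ->. Qed.

Fact free_comp1l n (x : F n) : free_comp ord0 (b (tree_leaf G)) x = x.
Proof.
move: x; apply: freeg_linear_ext => //; first exact: free_linr.
by move=> t; rewrite free_compU; congr << _ >>; apply: val_inj.
Qed.

Fact free_comp1r n (i : 'I_n.+1) (x : F n) :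
  transport (V := F) (addn0 n) (free_comp i x (b (tree_leaf G))) = x.
Proof.
move: x; apply: freeg_linear_ext => //.
  by move=> a x y; rewrite free_linl linearP.
by move=> t; rewrite free_compU; apply: transport_freeU; rewrite /= graft_leaf.
Qed.

Fact free_compA n m p (i : 'I_n.+1) (j : 'I_m.+1)
    (x : F n) (y : F m) (z : F p) :
  free_comp i x (free_comp j y z) =
  transport (V := F) (esym (addnA n m p))
    (free_comp (inord (i + j)) (free_comp i x y) z).
Proof.
move: x; apply: freeg_linear_ext.
- exact: free_linl.
- by move=> a x x'; rewrite !free_linl linearP.
move=> t; move: y; apply: freeg_linear_ext.
- by move=> a y y'; rewrite free_linl free_linr.
- by move=> a y y'; rewrite free_linr free_linl linearP.
move=> s; move: z; apply: freeg_linear_ext.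
- by move=> a z z'; rewrite !free_linr.
- by move=> a z z'; rewrite free_linr linearP.
move=> u; rewrite !free_compU; apply/esym/transport_freeU => /=.
have hi : (i <= n)%N by rewrite -ltnS.
have hj : (j <= m)%N by rewrite -ltnS.
rewrite inordK ?ltnS ?leq_add // graftA //.
  by rewrite (eqP (valP t)).
by rewrite (eqP (valP s)).
Qed.

Fact free_compC n m p (i j : 'I_n.+1)
    (x : F n) (y : F m) (z : F p) : (i < j)%N ->
  free_comp (inord (j + m)) (free_comp i x y) z =
  transport (V := F) (addnAC n p m)
    (free_comp (inord i) (free_comp j x z) y).
Proof.
move=> hij; move: x; apply: freeg_linear_ext.
- by move=> a x x'; rewrite !free_linl.
- by move=> a x x'; rewrite !free_linl linearP.
move=> t; move: y; apply: freeg_linear_ext.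
- by move=> a y y'; rewrite free_linr free_linl.
- by move=> a y y'; rewrite free_linr linearP.
move=> s; move: z; apply: freeg_linear_ext.
- by move=> a z z'; rewrite !free_linr.
- by move=> a z z'; rewrite free_linr free_linl linearP.
move=> u; rewrite !free_compU; apply/esym/transport_freeU => /=.
have hi : (i <= n)%N by rewrite -ltnS.
have hj : (j <= n)%N by rewrite -ltnS.
rewrite !inordK ?ltnS ?leq_add ?(leq_trans hi (leq_addr _ _)) //.
have := @graftC G i j (val t) (val s) (val u) hij.
by rewrite (eqP (valP t)) (eqP (valP s)) => ->.
Qed.

Definition free_operad : operad K :=
  Operad free_linl free_linr free_comp1l free_comp1r free_compA free_compC.

Definition free_gen (g : G) : free_operad 1%N := b (tree_corolla g).

End FreeOperadLaws.

Notation "x \o1 y" := (opd_comp (n := 1) (m := 1) ord0 x y)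
  (at level 40, left associativity).
Notation "x \o2 y" := (opd_comp (n := 1) (m := 1) ord_max x y)
  (at level 40, left associativity).

Record quadratic_presentation (K : fieldType) := QuadraticPresentation {
  qp_gen : finType;
  qp_rel : free_operad K qp_gen 2%N -> Prop
}.

Definition presented_operad (K : fieldType) (X : quadratic_presentation K) :
    operad K :=
  quotient_operad (gen_ideal (@qp_rel K X)).

Definition presented_class (K : fieldType) (X : quadratic_presentation K) n :
    free_operad K (qp_gen X) n -> presented_operad X n :=
  quotient_map (gen_ideal (@qp_rel K X)) n.

(** [x g] is the element of [O] that the presentation uses as the generator
    [g]: the isomorphism is required to match them. *)
Definition has_presentation (K : fieldType) (O : operad K)
    (X : quadratic_presentation K) (x : qp_gen X -> O 1%N) : Prop :=
  exists2 phi : operad_morphism (presented_operad X) O,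
    operad_isomorphism phi &
    forall g, phi 1%N (presented_class (free_gen K g)) = x g.

Section KoszulDual.
Variable K : fieldType.

(** Trees with two internal nodes are the [x \o1 y] (second node to the left)
    and the [x \o2 y] (second node to the right). *)
Definition koszul_sign (G : finType) (t : tree G 2) : K :=
  if val t is Node _ (Node _ _ _) _ then 1 else -1.

Definition koszul_form (G : finType) (x y : free_operad K G 2%N) : K :=
  fglift (fun t =>
    fglift (fun s => (if t == s then koszul_sign t else 0) : K^o) y) x.

Definition annihilator (G : finType) (R : free_operad K G 2%N -> Prop) :
    free_operad K G 2%N -> Prop :=
  fun x => forall r, R r -> koszul_form r x = 0.

Definition koszul_dual_presentation (X : quadratic_presentation K) :
    quadratic_presentation K :=
  QuadraticPresentation (annihilator (@qp_rel K X)).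

Section FormValues.
Variable G : finType.
Implicit Types x y : G.
Local Notation g := (@free_gen K G).

Lemma koszul_form11 x y x' y' :
  koszul_form (g x \o1 g y) (g x' \o1 g y') = ((x == x') && (y == y'))%:R.
Proof.
rewrite /= /free_gen !free_compU /koszul_form !fgliftU /koszul_sign /=.
rewrite -val_eqE /= ; case: (x =P x') => [->|h] /=; last first.
  by case: eqP => // -[].
case: (y =P y') => [->|h] /=; first by rewrite eqxx.
by case: eqP => // -[].
Qed.

Lemma koszul_form22 x y x' y' :
  koszul_form (g x \o2 g y) (g x' \o2 g y') = - ((x == x') && (y == y'))%:R.
Proof.
rewrite /= /free_gen !free_compU /koszul_form !fgliftU /koszul_sign /=.
rewrite -val_eqE /= ; case: (x =P x') => [->|h] /=; last first.
  by rewrite oppr0; case: eqP => // -[].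
case: (y =P y') => [->|h] /=; first by rewrite eqxx.
by rewrite oppr0; case: eqP => // -[].
Qed.

Lemma koszul_form12 x y x' y' : koszul_form (g x \o1 g y) (g x' \o2 g y') = 0.
Proof.
rewrite /= /free_gen !free_compU /koszul_form !fgliftU.
by rewrite -val_eqE /=; case: eqP.
Qed.

Lemma koszul_form21 x y x' y' : koszul_form (g x \o2 g y) (g x' \o1 g y') = 0.
Proof.
rewrite /= /free_gen !free_compU /koszul_form !fgliftU.
by rewrite -val_eqE /=; case: eqP.
Qed.

End FormValues.
End KoszulDual.

Section AsDAs.
Variables (K : fieldType) (gamma : nat).

(** The set [{1, ..., gamma}] is represented by ['I_gamma], shifted by one;
    [Order.max] is the operation written with an up arrow. *)
Local Notation gen := (@free_gen K 'I_gamma).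
Local Notation Free := (free_operad K 'I_gamma).

Definition as_relator (r : Free 2%N) : Prop :=
  exists a a' : 'I_gamma, let m := Order.max a a' in
    r = gen a \o1 gen a' - gen m \o2 gen m \/
    r = gen a \o2 gen a' - gen m \o2 gen m.

Definition as_presentation : quadratic_presentation K :=
  QuadraticPresentation (linspan as_relator).

Definition As : operad K := presented_operad as_presentation.

Definition das_presentation : quadratic_presentation K :=
  koszul_dual_presentation as_presentation.

Definition DAs : operad K := presented_operad das_presentation.

Definition diamond (b : 'I_gamma) : Free 1%N :=
  \sum_(a < gamma | (a <= b)%N) gen a.

Definition das_diamond (b : 'I_gamma) : DAs 1%N :=
  @presented_class K das_presentation 1%N (diamond b).

(** Here the generator of index [a] stands for the diamond of index [a], and
    not for the lozenge as above. *)
Definition diamond_relator (r : Free 2%N) : Prop :=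
  exists a : 'I_gamma,
    r = gen a \o1 gen a - gen a \o2 gen a.

Definition diamond_presentation : quadratic_presentation K :=
  QuadraticPresentation (linspan diamond_relator).

End AsDAs.

(* Main.v *)
(** Let [m] range over the indices and put
    [E_m = \sum_(max(b, c) = m) (l_b \o1 l_c - l_b \o2 l_c)], where [l_b] are
    the lozenges.  An element of arity three is orthogonal to the relations of
    [As] exactly when its coordinates on [l_b \o1 l_c] and [- l_b \o2 l_c]
    coincide and depend only on [max(b, c)], so the annihilator is spanned by
    the [E_m].  The associator of the diamond of index [b] is the sum of the
    [E_m] with [m <= b], hence both families span the same relations.  The
    substitution of the diamonds for the lozenges, inverted by taking successive
    differences, therefore induces mutually inverse morphisms between the two
    presented operads. *)
Require Import Defs.
From mathcomp Require Import all_boot all_order all_algebra.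
From HB Require Import structures.
From mathcomp Require Import freeg.
Import Order.TTheory GRing.Theory.

Set Implicit Arguments.
Unset Strict Implicit.
Unset Printing Implicit Defensive.

Local Open Scope ring_scope.

(** Operad axioms and the Koszul form give linearity as bare [linear] statements; bundling makes the
    theory of [{linear V -> W}] available for them. *)
Definition pack_linear (K : fieldType) (V W : lmodType K) (f : V -> W)
  (lf : linear f) : {linear V -> W} :=
  HB.pack f (GRing.isLinear.Build K V W _ f lf).

(** * Bilinearity of partial composition *)

Section OperadLinearity.
Variables (K : fieldType) (P : operad K) (n m : nat) (i : 'I_n.+1).

Lemma opd_comp0l (y : P m) : opd_comp i (0 : P n) y = 0.
Proof. exact: (linear0 (pack_linear (opd_linl i y))). Qed.

Lemma opd_comp0r (x : P n) : opd_comp i x (0 : P m) = 0.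
Proof. exact: (linear0 (pack_linear (opd_linr i x))). Qed.

Lemma opd_comp_sum (I J : Type) (r : seq I) (p : pred I) (s : seq J)
    (q : pred J) (x : I -> P n) (y : J -> P m) :
  opd_comp i (\sum_(a <- r | p a) x a) (\sum_(b <- s | q b) y b) =
  \sum_(a <- r | p a) \sum_(b <- s | q b) opd_comp i (x a) (y b).
Proof.
apply: (etrans (linear_sum (pack_linear (opd_linl i _)) _ _ _)).
by apply: eq_bigr => a _; exact: (linear_sum (pack_linear (opd_linr i (x a)))).
Qed.

End OperadLinearity.

(** In the total space [{n & P n}] the operad axioms hold without transport. *)
Section TotalComposition.
Variables (K : fieldType) (P : operad K).
Local Notation tot := {n & P n}.
Local Notation tg := (Tagged (fun n => P n : Type)).

Lemma Tagged_transport n m (e : n = m) (x : P n) :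
  tg (transport e x) = tg x.
Proof. by case: _ / e. Qed.

(** The position is a plain number, independent of the arity. [inord] sends an out-of-range position
    to 0, hence the bounds assumed below. *)
Definition tcomp (i : nat) (x y : tot) : tot :=
  tg (opd_comp (inord i) (tagged x) (tagged y)).

Lemma tcompE n m (i : 'I_n.+1) (x : P n) (y : P m) :
  tcomp i (tg x) (tg y) = tg (opd_comp i x y).
Proof. by rewrite /tcomp /= inord_val. Qed.

Lemma tcomp1r i x : (i <= tag x)%N -> tcomp i x (tg (opd_unit P)) = x.
Proof.
case: x => n x /= lein.
have := Tagged_transport (addn0 n) (opd_comp (inord i) x (opd_unit P)).
by rewrite opd_comp1r -tcompE inordK => // <-.
Qed.

Lemma tcomp1l x : tcomp 0 (tg (opd_unit P)) x = x.
Proof.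
by case: x => n x; rewrite (tcompE (@ord0 0)) opd_comp1l.
Qed.

Lemma tcompA i j x y z : (i <= tag x)%N -> (j <= tag y)%N ->
  tcomp i x (tcomp j y z) = tcomp (i + j) (tcomp i x y) z.
Proof.
case: x y z => [n x] [m y] [p z] /= lein lejm.
rewrite {1}/tcomp /= opd_compA Tagged_transport {2}/tcomp /=.
by rewrite /tcomp /= !inordK // ltnS.
Qed.

Lemma tcompC i j x y z : (i < j)%N -> (j <= tag x)%N ->
  tcomp (j + tag y) (tcomp i x y) z = tcomp i (tcomp j x z) y.
Proof.
case: x y z => [n x] [m y] [p z] /= ltij lejn.
have lti : (i < n.+1)%N by rewrite ltnS (leq_trans (ltnW ltij)).
rewrite /tcomp /=.
have := @opd_compC K P n m p (inord i) (inord j) x y z.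
by rewrite !inordK // => /(_ ltij) ->; rewrite Tagged_transport.
Qed.

End TotalComposition.


(** * Universal property of the free operad *)

Section FreeLift.
Variables (K : fieldType) (G : choiceType) (P : operad K) (f : G -> P 1%N).
Local Notation tg := (Tagged (fun n => P n : Type)).

(** Plugging the right subtree first keeps both insertion points at the leaves 1 and 0 of the
    corolla, with no shift by the size of the left subtree. *)
Fixpoint tree_eval (t : btree G) : {n & P n} :=
  if t is Node g l r then
    tcomp 0 (tcomp 1 (tg (f g)) (tree_eval r)) (tree_eval l)
  else tg (opd_unit P).

Lemma tag_tree_eval t : tag (tree_eval t) = nnodes t.
Proof. by elim: t => //= g l -> r ->; rewrite add1n addSn addnC. Qed.

(** Grafting into the left subtree is sequential associativity; grafting into the right one also
    needs the exchange of parallel compositions. *)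
Lemma tree_eval_graft i t s : (i <= nnodes t)%N ->
  tree_eval (graft i t s) = tcomp i (tree_eval t) (tree_eval s).
Proof.
elim: t i => [|g l IHl r IHr] i /= lei.
  by case: i lei => // _; rewrite tcomp1l.
case: ifP => hi /=.
  by rewrite IHl // tcompA ?tag_tree_eval.
have {}hi : (nnodes l < i)%N by rewrite ltnNge hi.
have hr : (i - (nnodes l).+1 <= nnodes r)%N by rewrite leq_subLR addSn.
rewrite IHr // tcompA ?tag_tree_eval //.
(* Exchanging with the left subtree shifts the position by [nnodes l], which restores [i]. *)
rewrite -tcompC ?tag_tree_eval //= ?add1n ?tag_tree_eval ?ltnS //.
by rewrite addSnnS subnK.
Qed.

Definition free_lift_tree n (t : tree G n) : P n :=
  etagged (etrans (tag_tree_eval (val t)) (eqP (valP t))).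

Lemma Tagged_free_lift_tree n (t : tree G n) :
  tg (free_lift_tree t) = tree_eval (val t).
Proof. exact: etaggedK. Qed.

Definition free_lift_map n : {linear free_operad K G n -> P n} :=
  pack_linear (fglift_is_linear (free_lift_tree (n := n))).

Lemma free_lift_mapU n (t : tree G n) :
  free_lift_map n << t >> = free_lift_tree t.
Proof. exact: fgliftU. Qed.

Lemma free_lift_unit : free_lift_map 0 (opd_unit (free_operad K G)) = opd_unit P.
Proof.
rewrite free_lift_mapU; apply: (@eq_from_Tagged _ (fun n => P n : Type)).
by rewrite Tagged_free_lift_tree.
Qed.

Lemma free_lift_comp n m (i : 'I_n.+1) (x : free_operad K G n)
    (y : free_operad K G m) :
  free_lift_map (n + m) (opd_comp i x y) =
  opd_comp i (free_lift_map n x) (free_lift_map m y).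
Proof.
move: x; apply: freeg_linear_ext.
- by move=> a x x'; rewrite (opd_linl (o := free_operad K G)) linearP.
- by move=> a x x'; rewrite linearP opd_linl.
move=> t; move: y; apply: freeg_linear_ext.
- by move=> a y y'; rewrite (opd_linr (o := free_operad K G)) linearP.
- by move=> a y y'; rewrite linearP opd_linr.
move=> s; rewrite /= free_compU !fgliftU.
apply: (@eq_from_Tagged _ (fun n => P n : Type)); rewrite -tcompE !Tagged_free_lift_tree /=.
by rewrite tree_eval_graft // (eqP (valP t)) -ltnS.
Qed.

Definition free_lift : operad_morphism (free_operad K G) P :=
  OperadMorphism free_lift_unit free_lift_comp.

Lemma free_lift_gen g : free_lift 1%N (free_gen K g) = f g.
Proof.
rewrite /free_gen free_lift_mapU; apply: (@eq_from_Tagged _ (fun n => P n : Type)).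
rewrite Tagged_free_lift_tree /= (tcomp1r (x := tg (f g))) //.
by rewrite (tcomp1r (x := tg (f g))).
Qed.

End FreeLift.

(** Every tree is an iterated composition of corollas, so the values on generators determine a
    morphism on the basis of trees. *)
Lemma free_morphism_ext (K : fieldType) (G : choiceType) (P : operad K)
    (phi psi : operad_morphism (free_operad K G) P) :
  (forall g, phi 1%N (free_gen K g) = psi 1%N (free_gen K g)) ->
  forall n, phi n =1 psi n.
Proof.
move=> eq_gen n; apply: freeg_linear_ext; try by move=> a x y; rewrite linearP.
case=> t; elim: t n => [|g l IHl r IHr] n /= nt; have en := eqP nt.
  case: _ / en nt => nt.
  suff -> : << exist _ Leaf nt >> = opd_unit (free_operad K G).
    by rewrite !opmap_unit.
  by congr << _ >>; apply: val_inj.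
pose bl : free_operad K G _ := << Sub l (eqxx (nnodes l)) : tree G _ >>.
pose br : free_operad K G _ := << Sub r (eqxx (nnodes r)) : tree G _ >>.
pose u := opd_comp (ord0 : 'I_((1 + nnodes r)%N).+1)
  (opd_comp (ord_max : 'I_2) (free_gen K g) br) bl.
have en' : (1 + nnodes r + nnodes l)%N = n by rewrite -en add1n addSn addnC.
have -> : << exist _ (Node g l r) nt >> = transport (V := free_operad K G) en' u.
  by rewrite /u /= !free_compU; apply/esym/transport_freeU.
case: _ / en' {nt en}; rewrite /u /transport /= !opmap_comp eq_gen.
by rewrite IHl IHr.
Qed.

(** * Composition of morphisms *)

Section MorphismComposition.
Variables (K : fieldType) (P Q R : operad K).

Definition id_morphism : operad_morphism P P :=
  @OperadMorphism K P P (fun n => idfun) erefl (fun n m i x y => erefl).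

Variables (psi : operad_morphism Q R) (phi : operad_morphism P Q).

Lemma comp_morphism_unit :
  (psi 0%N \o phi 0%N) (opd_unit P) = opd_unit R.
Proof. by rewrite /= !opmap_unit. Qed.

Lemma comp_morphism_comp n m (i : 'I_n.+1) (x : P n) (y : P m) :
  (psi (n + m)%N \o phi (n + m)%N) (opd_comp i x y) =
  opd_comp i ((psi n \o phi n) x) ((psi m \o phi m) y).
Proof. by rewrite /= !opmap_comp. Qed.

Definition comp_morphism : operad_morphism P R :=
  @OperadMorphism K P R (fun n => psi n \o phi n)
    comp_morphism_unit comp_morphism_comp.

End MorphismComposition.

(** * Universal property of the quotient by an ideal *)

Section QuotientMorphism.
Variables (K : fieldType) (P Q : operad K) (I : operad_ideal P).

Definition quotient_morphism : operad_morphism P (quotient_operad I) :=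
  @OperadMorphism K P (quotient_operad I) (quotient_map I) erefl
    (fun n m i x y => esym (opquot_compE I i x y)).

Variables (h : operad_morphism P Q).
Hypothesis hI : forall n (x : P n), I n x -> h n x = 0.

Definition quotient_lift_fun n (u : quotient_operad I n) : Q n := h n (repr u).

(** Two representatives of a class differ by an element of [I], on which [h] vanishes. *)
Lemma quotient_lift_class n (x : P n) :
  quotient_lift_fun (quotient_map I n x) = h n x.
Proof.
apply/eqP; rewrite -subr_eq0 -linearB; apply/eqP/hI.
by apply/opclassP; rewrite opclass_repr.
Qed.

Lemma quotient_lift_linear n : linear (@quotient_lift_fun n).
Proof.
move=> a u v; rewrite -[u]opclass_repr -[v]opclass_repr.
rewrite -[opclass I (repr u)]/(quotient_map I n _).
rewrite -[opclass I (repr v)]/(quotient_map I n _).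
by rewrite -linearP !quotient_lift_class linearP.
Qed.

Lemma quotient_lift_comp n m (i : 'I_n.+1) (u : quotient_operad I n)
    (v : quotient_operad I m) :
  quotient_lift_fun (opd_comp i u v) =
  opd_comp i (quotient_lift_fun u) (quotient_lift_fun v).
Proof. by rewrite quotient_lift_class opmap_comp. Qed.

Definition quotient_lift : operad_morphism (quotient_operad I) Q :=
  @OperadMorphism K (quotient_operad I) Q
    (fun n => pack_linear (@quotient_lift_linear n))
    (etrans (quotient_lift_class _) (opmap_unit h)) quotient_lift_comp.

Lemma quotient_liftE n (x : P n) :
  quotient_lift n (quotient_map I n x) = h n x.
Proof. exact: quotient_lift_class. Qed.

End QuotientMorphism.

(** The kernel of a morphism is an ideal, so it contains the ideal generated by any relations it
    contains. *)
Lemma gen_ideal_kernel (K : fieldType) (P Q : operad K) k (R : P k -> Prop)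
    (h : operad_morphism P Q) :
  (forall r, R r -> h k r = 0) ->
  forall n (x : P n), gen_ideal R n x -> h n x = 0.
Proof.
move=> hR n x; elim=> {n x} //.
- by move=> n; rewrite linear0.
- by move=> n a x y _ hx _ hy; rewrite linearP hx hy scaler0 addr0.
- by move=> n m i x y _ hx; rewrite opmap_comp hx opd_comp0l.
- by move=> n m i x y _ hy; rewrite opmap_comp hy opd_comp0r.
Qed.

(** * Morphisms out of a presented operad *)

Section PresentedOperad.
Variables (K : fieldType) (X : quadratic_presentation K).

Lemma presented_lift (P : operad K) (f : qp_gen X -> P 1%N) :
  (forall r, qp_rel r -> free_lift f 2 r = 0) ->
  exists phi : operad_morphism (presented_operad X) P,
    forall n x, phi n (presented_class x) = free_lift f n x.
Proof.
move=> fR; exists (quotient_lift (gen_ideal_kernel fR)) => n x.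
exact: quotient_liftE.
Qed.

Lemma presented_morphism_ext (P : operad K)
    (phi psi : operad_morphism (presented_operad X) P) :
  (forall g, phi 1%N (presented_class (free_gen K g)) =
             psi 1%N (presented_class (free_gen K g))) ->
  forall n, phi n =1 psi n.
Proof.
move=> eq_gen n u; rewrite -[u]opclass_repr.
pose q := quotient_morphism (gen_ideal (@qp_rel K X)).
exact: (free_morphism_ext (phi := comp_morphism phi q)
  (psi := comp_morphism psi q)).
Qed.

End PresentedOperad.

(** Both composites fix the generators, hence are identities. *)
Lemma inverse_morphisms_presentation (K : fieldType)
    (X Y : quadratic_presentation K) (x : qp_gen X -> presented_operad Y 1%N)
    (phi : operad_morphism (presented_operad X) (presented_operad Y))
    (psi : operad_morphism (presented_operad Y) (presented_operad X)) :
  (forall g, phi 1%N (presented_class (free_gen K g)) = x g) ->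
  (forall g, psi 1%N (x g) = presented_class (free_gen K g)) ->
  (forall g, phi 1%N (psi 1%N (presented_class (free_gen K g))) =
             presented_class (free_gen K g)) ->
  has_presentation x.
Proof.
move=> phiE psiK phiK; exists phi => // n; exists (psi n).
- apply: (presented_morphism_ext (phi := comp_morphism psi phi)
    (psi := id_morphism _)) => g.
  by rewrite /= phiE psiK.
- exact: (presented_morphism_ext (phi := comp_morphism phi psi)
    (psi := id_morphism _)).
Qed.

(** * The bilinear form in arity three *)

Section KoszulForm.
Variables (K : fieldType) (G : finType).
Local Notation F2 := (free_operad K G 2%N).
Local Notation g := (@free_gen K G).

Lemma koszul_form_linl (y : F2) : linear (fun x : F2 => koszul_form x y : K^o).
Proof. exact: fglift_is_linear. Qed.

Lemma koszul_form_linr (x : F2) : linear (fun y : F2 => koszul_form x y : K^o).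
Proof.
move=> a y y'; move: x; apply: freeg_linear_ext.
- exact: koszul_form_linl.
- move=> c x x' /=; rewrite !koszul_form_linl !scalerDr !scalerA (mulrC a).
  by rewrite addrACA.
- by move=> t; rewrite /koszul_form !fgliftU fglift_is_linear.
Qed.

Lemma quadratic_tree_ind (Q : F2 -> Prop) :
  (forall x y, Q (g x \o1 g y)) -> (forall x y, Q (g x \o2 g y)) ->
  forall t : tree G 2, Q << t >>.
Proof.
move=> Q1 Q2 t.
case Et: (val t) (valP t) => [|x [|y l1 l2] [|z r1 r2]] //= nt; last first.
(* Two non-leaf children of the root would give at least three nodes. *)
- by exfalso; move: nt; rewrite addSn addnS.
- suff -> : << t >> = g x \o1 g y by apply: Q1.
  rewrite /= /free_gen !free_compU; congr << _ >>; apply: val_inj => /=.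
  by rewrite Et; case: l1 l2 nt {Et} => [|? ? ?] [|? ? ?].
- suff -> : << t >> = g x \o2 g z by apply: Q2.
  rewrite /= /free_gen !free_compU; congr << _ >>; apply: val_inj => /=.
  by rewrite Et; case: r1 r2 nt {Et} => [|? ? ?] [|? ? ?].
Qed.

(* The form is diagonal with entries 1 and -1 on the basis of trees. *)
Lemma koszul_form_expansion (x : F2) :
  x = \sum_p (koszul_form (g p.1 \o1 g p.2) x *: (g p.1 \o1 g p.2)
            - koszul_form (g p.1 \o2 g p.2) x *: (g p.1 \o2 g p.2)).
Proof.
pose e (z : F2) : F2 :=
  \sum_p (koszul_form (g p.1 \o1 g p.2) z *: (g p.1 \o1 g p.2)
        - koszul_form (g p.1 \o2 g p.2) z *: (g p.1 \o2 g p.2)).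
move: x; apply: (@freeg_linear_ext K (tree G 2) F2 id e) => //.
  move=> a y z; rewrite /e scaler_sumr -big_split; apply: eq_bigr => p _ /=.
  rewrite !koszul_form_linr !scalerDl scalerBr !scalerA.
  by rewrite opprD addrACA.
apply: (quadratic_tree_ind (Q := fun z => z = e z)) => b c; rewrite /e /=.
- rewrite (bigD1 (b, c)) //= koszul_form11 koszul_form21 !eqxx scale1r scale0r.
  rewrite subr0 big1 ?addr0 // => -[b' c'] /=; rewrite xpair_eqE => /negPf ne.
  by rewrite koszul_form11 koszul_form21 ne !scale0r subr0.
- rewrite (bigD1 (b, c)) //= koszul_form12 koszul_form22 !eqxx scale0r scaleN1r.
  rewrite sub0r opprK big1 ?addr0 // => -[b' c'] /=; rewrite xpair_eqE => /negPf ne.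
  by rewrite koszul_form12 koszul_form22 ne oppr0 !scale0r subr0.
Qed.

End KoszulForm.

(** * Pairing with compositions of diamonds *)

Section Diamonds.
Variables (K : fieldType) (gamma : nat).
Local Notation gen := (@free_gen K 'I_gamma).
Implicit Types a b c : 'I_gamma.

(** Identifies the squares of indices arising from compositions of partial sums with sublevel sets
    of the maximum. *)
Lemma max_ord_lt b c n :
  (Order.max b c < n)%N = (b < n)%N && (c < n)%N.
Proof.
rewrite /Order.max; case: ifP => [|/negbT]; rewrite -?leNgt /Order.lt /Order.le /=.
  by move=> bc; case cn: (c < n)%N; rewrite ?andbF // (ltn_trans bc cn).
move=> bc; case bn: (b < n)%N => //=; apply/esym; exact: leq_ltn_trans bc bn.
Qed.

Lemma max_ord_le b c n :
  (Order.max b c <= n)%N = (b <= n)%N && (c <= n)%N.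
Proof. by rewrite -![(_ <= n)%N]ltnS max_ord_lt. Qed.

Lemma koszul_form_diamond (i : 'I_2) (r : free_operad K 'I_gamma 2%N) a :
  koszul_form r (opd_comp (m := 1) i (diamond K a) (diamond K a)) =
  \sum_(b < gamma | (b <= a)%N) \sum_(c < gamma | (c <= a)%N)
    koszul_form r (opd_comp (m := 1) i (gen b) (gen c)).
Proof.
rewrite /diamond opd_comp_sum.
apply: etrans (linear_sum (pack_linear (koszul_form_linr r)) _ _ _) _.
apply: eq_bigr => b _; exact: (linear_sum (pack_linear (koszul_form_linr r))).
Qed.

Lemma sum_delta2 (a b c : 'I_gamma) :
  \sum_(b' < gamma | (b' <= a)%N) \sum_(c' < gamma | (c' <= a)%N)
    ((b == b') && (c == c'))%:R = ((b <= a)%N && (c <= a)%N)%:R :> K.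
Proof.
rewrite pair_big_dep /= big_mkcond (bigD1 (b, c)) //= !eqxx /=.
rewrite big1 ?addr0; first by case: ifP.
move=> -[b' c'] /=; rewrite xpair_eqE ![_ == b]eq_sym ![_ == c]eq_sym => /negPf ->.
by rewrite if_same.
Qed.

End Diamonds.

(** * Matching the diamond relations with the annihilator *)

Section DAsPresentation.
Variables (K : fieldType) (gamma : nat).
Local Notation gen := (@free_gen K 'I_gamma).
Local Notation Free := (free_operad K 'I_gamma).
Local Notation DP := (diamond_presentation K gamma).
Implicit Types a b c : 'I_gamma.

(** Either composition of generators [p], [q] pairs with the diamond associator to 1 if
    [max(p, q) <= a] and to 0 otherwise; a relator of [As] is a difference of two trees with the
    same maximum. *)
Lemma diamond_relation_annihilator a :
  annihilator (linspan (@as_relator K gamma))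
    (diamond K a \o1 diamond K a - diamond K a \o2 diamond K a).
Proof.
move=> r; set x := _ - _.
elim=> [|k s r' [b [c sE]] _ IHr].
  exact: (linear0 (pack_linear (koszul_form_linl x))).
rewrite koszul_form_linl IHr addr0.
suff -> : koszul_form s x = 0 by exact: mulr0.
have formB u v : koszul_form (u - v) x = koszul_form u x - koszul_form v x.
  exact: (linearB (pack_linear (koszul_form_linl x))).
have formBr u y z :
    koszul_form u (y - z : Free 2%N) = koszul_form u y - koszul_form u z.
  exact: (linearB (pack_linear (koszul_form_linr u))).
have form1 p q : koszul_form (gen p \o1 gen q) x = ((p <= a)%N && (q <= a)%N)%:R.
  rewrite /x formBr !koszul_form_diamond -sum_delta2.
  rewrite [X in _ - X]big1 ?subr0; last first.
    by move=> b' _; apply: big1 => c' _; exact: koszul_form12.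
  by apply: eq_bigr => b' _; apply: eq_bigr => c' _; exact: koszul_form11.
(* The sign of the form on [\o2] cancels the sign in the associator. *)
have form2 p q : koszul_form (gen p \o2 gen q) x = ((p <= a)%N && (q <= a)%N)%:R.
  rewrite /x formBr !koszul_form_diamond -sum_delta2.
  rewrite [X in X - _]big1 ?sub0r; last first.
    by move=> b' _; apply: big1 => c' _; exact: koszul_form21.
  rewrite -sumrN; apply: eq_bigr => b' _; rewrite -sumrN.
  by apply: eq_bigr => c' _; rewrite koszul_form22 opprK.
by case: sE => ->; rewrite formB ?form1 !form2 max_ord_le andbb subrr.
Qed.

Lemma das_diamond_relation a :
  das_diamond K a \o1 das_diamond K a = das_diamond K a \o2 das_diamond K a.
Proof.
rewrite /= !opquot_compE; apply/opclassP.
by apply: gen_ideal_in; exact: diamond_relation_annihilator.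
Qed.

(** With [diamond_upto n] the diamond of index [n] in the paper's numbering and
    [diamond_upto 0 = 0], the lozenges are the successive differences. *)
Definition diamond_upto (n : nat) : presented_operad DP 1%N :=
  \sum_(a < gamma | a.+1 == n) presented_class (X := DP) (gen a).

Definition lozenge b : presented_operad DP 1%N :=
  diamond_upto b.+1 - diamond_upto b.

Lemma diamond_uptoS b : diamond_upto b.+1 = presented_class (X := DP) (gen b).
Proof. by rewrite /diamond_upto (big_pred1 b). Qed.

Lemma diamond_upto0 : diamond_upto 0 = 0.
Proof. exact: big_pred0. Qed.

Lemma sum_lozenge n : (n <= gamma)%N ->
  \sum_(b < gamma | (b < n)%N) lozenge b = diamond_upto n.
Proof.
move=> le_n; pose d m := diamond_upto m.+1 - diamond_upto m.
rewrite -(big_ord_widen _ d) // -(big_mkord xpredT d) /d.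
by rewrite telescope_sumr // diamond_upto0 subr0.
Qed.

(** The value [n = 0] is included so that the first lozenge is also a difference of two elements
    with vanishing associator. *)
Lemma diamond_upto_relation n : (n <= gamma)%N ->
  diamond_upto n \o1 diamond_upto n = diamond_upto n \o2 diamond_upto n.
Proof.
case: n => [|n] lt_n; first by rewrite diamond_upto0 !opd_comp0l.
rewrite (diamond_uptoS (Ordinal lt_n)) /= !opquot_compE; apply/opclassP.
set r := _ - _; rewrite -[r]scale1r -[1 *: r]addr0.
apply: gen_ideal_in; apply: linspan_lin; last exact: linspan0.
by exists (Ordinal lt_n).
Qed.

Definition lozenge_associator (p : 'I_gamma * 'I_gamma) :
    presented_operad DP 2%N :=
  lozenge p.1 \o1 lozenge p.2 - lozenge p.1 \o2 lozenge p.2.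

(** By bilinearity this sum is the associator of [diamond_upto n]. *)
Lemma sum_associator_lt n : (n <= gamma)%N ->
  \sum_(p : 'I_gamma * 'I_gamma | (Order.max p.1 p.2 < n)%N)
    lozenge_associator p = 0.
Proof.
move=> le_n; have := diamond_upto_relation le_n; rewrite -sum_lozenge //.
rewrite !opd_comp_sum !pair_big_dep /= => /eqP; rewrite -subr_eq0 -sumrB.
move/eqP; apply: etrans.
by apply: eq_big => p; rewrite ?max_ord_lt.
Qed.

(** A level set of the maximum is the difference of two consecutive strict sublevel sets. *)
Lemma sum_associator_eq a :
  \sum_(p : 'I_gamma * 'I_gamma | Order.max p.1 p.2 == a) lozenge_associator p = 0.
Proof.
have := sum_associator_lt (ltn_ord a).
rewrite (bigID (fun p : 'I_gamma * 'I_gamma => Order.max p.1 p.2 == a)) /=.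
rewrite [X in _ + X](eq_bigl
  (fun p : 'I_gamma * 'I_gamma => (Order.max p.1 p.2 < a)%N)); last first.
  by move=> p; rewrite ltnS [(_ < a)%N]ltn_neqAle andbC.
(* Only the right-hand side is rewritten; the first zero is the neutral element of the sum. *)
rewrite sum_associator_lt ?addr0 // 1?ltnW // => {2}<-.
by apply: eq_bigl => p; case: eqP => [->|]; rewrite ?ltnSn ?andbF.
Qed.

(** Orthogonality to the relators makes the coordinates of [x] a function [k] of the maximum, so its
    image is a combination of the vanishing sums of [sum_associator_eq]. *)
Lemma lozenge_annihilator_kernel (x : Free 2%N) :
  annihilator (linspan (@as_relator K gamma)) x -> free_lift lozenge 2 x = 0.
Proof.
move=> annx.
have formB (u v : Free 2%N) :
    as_relator (u - v) -> koszul_form u x = koszul_form v x.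
  move=> uv; apply/eqP; rewrite -subr_eq0.
  rewrite -[_ - _](linearB (pack_linear (koszul_form_linl x))) /=.
  apply/eqP/annx; rewrite -[_ - _]scale1r -[1 *: _]addr0.
  by apply: linspan_lin => //; exact: linspan0.
pose k a := koszul_form (gen a \o2 gen a) x.
have form1 b c : koszul_form (gen b \o1 gen c) x = k (Order.max b c).
  by apply: formB; exists b, c; left.
have form2 b c : koszul_form (gen b \o2 gen c) x = k (Order.max b c).
  by apply: formB; exists b, c; right.
rewrite (koszul_form_expansion x) linear_sum.
transitivity (\sum_p k (Order.max p.1 p.2) *: lozenge_associator p).
  apply: eq_bigr => -[b c] _; rewrite linearB !linearZ_LR form1 form2.
  rewrite !opmap_comp !free_lift_gen.
  by rewrite -scalerDr.
rewrite (partition_big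
  (fun p : 'I_gamma * 'I_gamma => Order.max p.1 p.2) xpredT) //=.
apply: big1 => a _; apply: etrans (scaler0 _ (k a)).
apply: etrans (congr1 _ (sum_associator_eq a)); rewrite scaler_sumr.
by apply: eq_bigr => p /eqP ->.
Qed.

End DAsPresentation.

(** * The two inverse morphisms between the presented operads *)

Theorem proposition5p1p3 (K : fieldType) (charK : [pchar K] =i pred0)
    (gamma : nat) :
  @has_presentation K (DAs K gamma) (diamond_presentation K gamma)
    (@das_diamond K gamma).
Proof.
have [phi phiE] : exists phi : operad_morphism
    (presented_operad (diamond_presentation K gamma)) (DAs K gamma),
    forall n x, phi n (presented_class x) = free_lift (@das_diamond K gamma) n x.
  apply: presented_lift => r; elim=> [|k s r' [a ->] _ IHr].
    by rewrite linear0.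
  rewrite linearP IHr addr0 linearB !opmap_comp !free_lift_gen.
  by rewrite das_diamond_relation subrr scaler0.
(* [psi] sends each lozenge to the difference of consecutive diamonds. *)
have [psi psiE] := presented_lift (X := das_presentation K gamma)
  (@lozenge_annihilator_kernel K gamma).
have phi_gen a : phi 1%N (presented_class (free_gen K a)) = das_diamond K a.
  by rewrite phiE free_lift_gen.
have psi_diamond a : psi 1%N (das_diamond K a) = diamond_upto K gamma a.+1.
  (* The sum telescopes; its range [a < b.+1] is by computation the range [a <= b] of [diamond]. *)
  rewrite -sum_lozenge // /das_diamond psiE linear_sum.
  by apply: eq_bigr => b _; rewrite free_lift_gen.
have phi_upto n : (n <= gamma)%N -> phi 1%N (diamond_upto K gamma n) =
    presented_class (X := das_presentation K gamma)
      (\sum_(a < gamma | (a < n)%N) free_gen K a).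
  case: n => [|n] lt_n.
    by rewrite diamond_upto0 big_pred0 // linear0 /presented_class linear0.
  by rewrite (diamond_uptoS K (Ordinal lt_n)) phi_gen.
apply: (inverse_morphisms_presentation phi_gen (psi := psi)) => a.
  by rewrite psi_diamond diamond_uptoS.
rewrite psiE free_lift_gen /lozenge linearB !phi_upto ?(ltnW (ltn_ord a)) //.
rewrite /presented_class -linearB; congr (quotient_map _ _ _).
(* The partial sums up to [a] included and excluded differ by the generator [a] alone. *)
rewrite (bigD1 a) //= (eq_bigl (fun b : 'I_gamma => b < a)%N) ?addrK // => b.
by rewrite ltnS [(b < a)%N]ltn_neqAle andbC.
Qed.
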